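(* The stochasticity gap of the linear program $$\max\sum_{u\in U}\sum_{v\in V}x_{u,v}p_{u,v}w_u\quad\text{s.t.}\quad \sum_{v}x_{u,v}p_{u,v}\le1\ \forall u,\ \ \sum_u x_{u,v}p_{u,v}\le 1\ \forall v,\ \ \sum_u x_{u,v}\le\mathbb{E}[\theta_v]\ \forall v,\ \ 0\le x_{u,v}\le1,$$ is at most $2-2\gamma-\gamma^2\approx 0.544$, where $\gamma$ is the solution of $\gamma=e^{-\gamma}$. That is, the infimum over instances of the ratio of the expected weight of an optimal offline probing algorithm to the optimal value of this LP is at most this constant.
   Context: Instance: bipartite graph with offline vertices $U$ (weights $w_u\ge0$) and online vertices $V$; independent edge existence probabilities $p_{u,v}$; each online vertex $v$ has a patience $\theta_v$ (positive integer, possibly random). An offline probing algorithm knows the instance, probes edges adaptively in any order, each at most once; an existing probed edge between two unmatched vertices must be matched irrevocably (earning $w_u$); an online vertex $v$ can have at most $\theta_v$ failed probes. The stochasticity gap of an LP relaxation is the infimum over instances of (optimal expected matched weight of such an offline algorithm)/(optimal LP value). *)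

(* Defs.v *)
From HB Require Import structures.
From mathcomp Require Import all_boot all_order all_algebra.
From mathcomp Require Import all_classical all_reals all_analysis.

Set Implicit Arguments.
Unset Strict Implicit.
Unset Printing Implicit Defensive.

Import Order.TTheory GRing.Theory Num.Theory.
Local Open Scope classical_set_scope.
Local Open Scope ring_scope.

(* The patience of v is a random positive integer of law [patience v]; the
   patiences and the existence of the edges are all mutually independent. A
   deterministic patience k is the Dirac law at k. The mean of a patience may
   be infinite. *)
Record instance (R : realType) := Instance {
  offline : finType;
  online : finType;
  weight : offline -> R;
  prob : offline -> online -> R;
  patience : online -> probability nat R;
  weight_ge0 : forall u, 0 <= weight u;
  prob_01 : forall u v, 0 <= prob u v <= 1;
  patience_gt0 : forall v, patience v [set 0%N] = 0%E
}.

Section Probing.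
Variables (R : realType) (I : instance R).

Definition edge : finType := (offline I * online I)%type.

(* [timeout] tells whether this probe used up the patience of the online
   endpoint: the algorithm learns a patience only when it is exhausted. *)
Record observation := Observation {
  probed : edge;
  exists_edge : bool;
  timeout : bool
}.

Definition history := seq observation.

(* Adaptive choice of the next edge to probe; [None] means stopping. *)
Definition policy := history -> option edge.

(* The set of existing edges and the patiences. *)
Definition scenario := ({set edge} * {ffun online I -> nat})%type.

Definition failures (h : history) (v : online I) : nat :=
  count (fun o => ((probed o).2 == v) && ~~ exists_edge o) h.

Definition can_probe (z : scenario) (h : history) (e : edge) : bool :=
  (e \notin map probed h) && (failures h e.2 < z.2 e.2)%N.

Definition observe (z : scenario) (h : history) (e : edge) : observation :=
  let ex := e \in z.1 in
  Observation e ex (~~ ex && ((failures h e.2).+1 == z.2 e.2)).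

(* An attempt at a forbidden probe ends the run. *)
Fixpoint run (pi : policy) (z : scenario) (n : nat) (h : history) : history :=
  if n is n'.+1 then
    if pi h is Some e then
      if can_probe z h e then run pi z n' (rcons h (observe z h e)) else h
    else h
  else h.

Definition unmatched (M : {set edge}) (e : edge) : bool :=
  [forall f in M, (f.1 != e.1) && (f.2 != e.2)].

Definition matching (h : history) : {set edge} :=
  foldl (fun M o => if exists_edge o && unmatched M (probed o)
                    then probed o |: M else M) finset.set0 h.

(* No edge is probed twice, so #|edge| steps always suffice. *)
Definition reward (pi : policy) (z : scenario) : R :=
  \sum_(e in matching (run pi z #|edge| [::])) weight e.1.

Definition scenario_prob (z : scenario) : R :=
  (\prod_(e : edge) (if e \in z.1 then prob e.1 e.2 else 1 - prob e.1 e.2)) *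
  \prod_(v : online I) fine (patience v [set z.2 v]).

(* A policy drawn at random, independently of the scenario. For a given instance
   only finitely many policies behave differently, so finitely many seeds lose
   no generality. *)
Record algorithm := Algorithm {
  seeds : nat;
  seed_prob : 'I_seeds -> R;
  policy_of : 'I_seeds -> policy;
  seed_prob_ge0 : forall s, 0 <= seed_prob s;
  seed_prob_sum : \sum_s seed_prob s = 1
}.

Definition expected_weight (A : algorithm) : \bar R :=
  (\sum_(s < seeds A) (seed_prob s)%:E *
     \esum_(z in [set: scenario]) (scenario_prob z * reward (policy_of s) z)%:E)%E.

Definition opt : \bar R := ereal_sup (range expected_weight).

Definition lp_feasible (x : offline I -> online I -> R) : Prop :=
  [/\ forall u, \sum_v x u v * prob u v <= 1,
      forall v, \sum_u x u v * prob u v <= 1,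
      forall v, ((\sum_u x u v)%:E <= 'E_(patience v)[fun k : nat => k%:R])%E
    & forall u v, 0 <= x u v <= 1].

Definition lp_objective (x : offline I -> online I -> R) : R :=
  \sum_u \sum_v x u v * prob u v * weight u.

Definition lp_value : \bar R :=
  ereal_sup [set (lp_objective x)%:E | x in lp_feasible].

End Probing.

(* Instances whose relaxation has value 0 are excluded: the ratio 0 / 0 is
   meaningless, and division by zero would make the infimum 0. *)
Definition stochasticity_gap (R : realType) (lp : instance R -> \bar R) : \bar R :=
  ereal_inf [set r | exists I : instance R, (0 < lp I)%E /\ r = (opt I / lp I)%E].

(* Main.v *)
(* Take a d-regular bipartite graph of large girth with edge probabilities 1/d,
   unit weights and unlimited patience. Putting x = 1 everywhere shows that the
   linear program has value n, the number of offline vertices, while the weight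
   of any algorithm is at most the size of a vertex cover of the set of existing
   edges. Karp-Sipser messages m (a vertex sends 1 to a neighbour iff it
   receives 0 from all its other neighbours) yield a cover: online vertices that
   receive at least one 1 and offline vertices that receive at least two.
   Truncated below the girth, messages from distinct neighbours are independent
   and equal to 1 with probability q_(t+1) = (1 - q_t / d)^(d - 1), which tends
   to gamma as t and d grow, so the cover has size about
   n (1 - e^-gamma) + n (1 - e^-gamma - gamma e^-gamma)
   = n (2 - 2 gamma - gamma^2).
   The graph is the bipartite double cover of the Cayley graph of a permutation
   group in which d involutions act on a ball of the d-regular tree. *)
Require Import Defs.
From HB Require Import structures.
From mathcomp Require Import all_boot all_order all_algebra all_fingroup.
From mathcomp Require Import all_classical all_reals all_analysis.
From mathcomp Require Import ring lra.
Import Order.TTheory GRing.Theory Num.Theory.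
Import numFieldNormedType.Exports.
Local Open Scope ring_scope.
Set Implicit Arguments.
Unset Strict Implicit.
Unset Printing Implicit Defensive.

(** * Random edge sets *)

Section BernoulliSet.
Variables (R : comRingType) (T : finType) (p : T -> R).
Implicit Types (E F : {set T}) (f g : {set T} -> R) (A B : T -> Prop).

Definition bern (E : {set T}) : R :=
  \prod_e (if e \in E then p e else 1 - p e).

Definition mean (f : {set T} -> R) : R := \sum_E bern E * f E.

Definition determined_by (U : Type) (A : T -> Prop) (f : {set T} -> U) : Prop :=
  forall E F, (forall e, A e -> (e \in E) = (e \in F)) -> f E = f F.

Lemma eq_mean f g : f =1 g -> mean f = mean g.
Proof. by move=> fg; apply: eq_bigr => E _; rewrite fg. Qed.

Lemma mean_cst (c : R) : mean (fun=> c) = c.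
Proof.
rewrite /mean -mulr_suml -(bigA_distr _ _ p (fun e => 1 - p e)).
by rewrite big1 ?mul1r // => e _; rewrite /= addrCA subrr addr0.
Qed.

Lemma meanD f g : mean (fun E => f E + g E) = mean f + mean g.
Proof. by rewrite /mean -big_split; apply: eq_bigr => E _; rewrite mulrDr. Qed.

Lemma meanN f : mean (fun E => - f E) = - mean f.
Proof. by rewrite /mean -sumrN; apply: eq_bigr => E _; rewrite mulrN. Qed.

Lemma meanB f g : mean (fun E => f E - g E) = mean f - mean g.
Proof. by rewrite meanD meanN. Qed.

Lemma mean_sum (J : finType) (f : J -> {set T} -> R) :
  mean (fun E => \sum_j f j E) = \sum_j mean (f j).
Proof.
by rewrite /mean exchange_big; apply: eq_bigr => E _; rewrite mulr_sumr.
Qed.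

(* Exchanging the B-parts of two independent copies preserves their joint law
   and turns f E * g F into f E * g E. *)
Lemma meanM A B f g : (forall e, A e -> ~ B e) ->
  determined_by A f -> determined_by B g ->
  mean (fun E => f E * g E) = mean f * mean g.
Proof.
move=> dAB fA gB.
pose sw (X : {set T} * {set T}) : {set T} * {set T} :=
  (finset.finset (fun e => if `[< B e >] then e \in X.2 else e \in X.1),
   finset.finset (fun e => if `[< B e >] then e \in X.1 else e \in X.2)).
have swK : involutive sw.
  by move=> [E F]; congr (_, _); apply/setP => e;
    rewrite !inE /=; case: `[< B e >].
have bsw X : bern (sw X).1 * bern (sw X).2 = bern X.1 * bern X.2.
  rewrite /bern -!big_split; apply: eq_bigr => e _ /=; rewrite !inE.
  by case: `[< B e >] => //; rewrite mulrC.
(* The factor 1, written as the mean of a constant, brings in the second copy. *)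
rewrite -[LHS]mulr1 -[in LHS](mean_cst 1) /mean !big_distrlr /= !pair_bigA /=.
rewrite (reindex_inj (inv_inj swK)); apply: eq_bigr => -[E F] _ /=.
have -> : f (sw (E, F)).1 = f E.
  by apply: fA => e Ae; rewrite inE asboolF //; exact: dAB.
have -> : g (sw (E, F)).1 = g F by apply: gB => e Be; rewrite inE asboolT.
by have /= := bsw (E, F); set x := bern _; set y := bern _ => xy; ring: xy.
Qed.

Lemma mean_prod (J : eqType) (r : seq J) (A : J -> T -> Prop)
    (f : J -> {set T} -> R) : uniq r ->
  {in r &, forall i j e, i != j -> A i e -> ~ A j e} ->
  {in r, forall i, determined_by (A i) (f i)} ->
  mean (fun E => \prod_(i <- r) f i E) = \prod_(i <- r) mean (f i).
Proof.
elim: r => [|i r IHr] /=.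
  by move=> _ _ _; rewrite big_nil -[RHS]mean_cst; apply: eq_mean => E;
    rewrite big_nil.
move=> /andP[ir ur] dA fA; rewrite big_cons -IHr //; first last.
- by move=> j jr; apply: fA; rewrite inE jr orbT.
- by move=> j k jr kr; apply: dA; rewrite inE ?jr ?kr orbT.
rewrite -(@meanM (A i) (fun e => exists2 j, j \in r & A j e)).
- by apply: eq_mean => E; rewrite big_cons.
- move=> e Aie [j jr Aje]; apply: (dA i j _ _ e) => //; rewrite ?inE ?eqxx//.
    by rewrite jr orbT.
  by apply: contraNneq ir => ->.
- by apply: fA; rewrite inE eqxx.
- move=> E F EF; rewrite !big_seq; apply: eq_bigr => j jr.
  by apply: (fA j) => [|e Aje]; [rewrite inE jr orbT | apply: EF; exists j].
Qed.

Lemma mean_in e : mean (fun E => (e \in E)%:R) = p e.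
Proof.
rewrite /mean.
(* Putting 0 in place of [1 - p e] discards the sets without [e] and keeps the product form. *)
transitivity (\sum_(E : {set T}) \prod_x
   (if x \in E then p x else if x == e then 0 else 1 - p x)).
  apply: eq_bigr => E _; rewrite /bern (bigD1 e) //= [RHS](bigD1 e) //= eqxx.
  case: (e \in E); last by rewrite mulr0 mul0r.
  by rewrite mulr1; congr (_ * _); apply: eq_bigr => x /negPf ->.
rewrite -(bigA_distr _ _ p (fun x => if x == e then 0 else 1 - p x)).
rewrite (bigD1 e) //= eqxx addr0 big1 ?mulr1 // => x /negPf ->.
by rewrite /= addrCA subrr addr0.
Qed.

End BernoulliSet.

(** * A regular graph of large girth *)

Definition reduced (T : eqType) (w : seq T) : bool :=
  sorted (fun x y => x != y) w.

Lemma reduced_rev (T : eqType) (w : seq T) : reduced (rev w) = reduced w.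
Proof.
by rewrite /reduced rev_sorted; apply: eq_sorted => x y; rewrite eq_sym.
Qed.

Lemma reduced_cons (T : eqType) (x : T) w :
  reduced (x :: w) = (ohead w != Some x) && reduced w.
Proof. by case: w => //= y w; rewrite /reduced /= eq_sym. Qed.

Section Toggle.
Variables (K : nat) (T : finType).
Implicit Types (x y : T) (w : seq T).

(* The vertices of the ball of radius K in the #|T|-regular tree are the reduced
   words; [toggle x] exchanges the ends of the edges of colour x and fixes the
   words whose x-edge leaves the ball. *)
Definition toggle x w : seq T :=
  if ~~ reduced w then w
  else if ohead w == Some x then behead w
  else if (size w < K)%N then x :: w else w.

Lemma size_toggle x w : (size w <= K)%N -> (size (toggle x w) <= K)%N.
Proof.
move=> wK; rewrite /toggle; case: ifP => // _.
by case: ifP => _; [case: w wK => //= y w /ltnW | case: ifP].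
Qed.

Lemma toggleK x w : (size w <= K)%N -> toggle x (toggle x w) = w.
Proof.
move=> wK; rewrite {2}/toggle; case: ifPn => [nr|/negPn rw].
  by rewrite /toggle nr.
case: ifPn => [|hw].
  case: w wK rw => [//|y w] wK rw /eqP[yx]; subst y.
  move: rw; rewrite reduced_cons => /andP[hw rw].
  by rewrite /toggle rw (negPf hw) wK.
case: ifPn => wK'; last by rewrite /toggle rw (negPf hw) (negPf wK').
by rewrite /toggle reduced_cons hw rw /= eqxx.
Qed.

(** The finite type [K.-bseq T] contains the ball; its non-reduced words are fixed by every toggle.
    Since [toggle] respects the bound [K], the value is [toggle x w] and not the default of
    [insubd]. *)
Definition toggle_bseq x (w : K.-bseq T) : K.-bseq T := insubd w (toggle x w).

Lemma toggle_bseqK x : involutive (toggle_bseq x).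
Proof.
have vE (w : K.-bseq T) : toggle_bseq x w = toggle x w :> seq T.
  by rewrite val_insubd size_toggle ?size_bseq.
by move=> w; apply: val_inj; rewrite /= !vE toggleK ?size_bseq.
Qed.

Definition generator x : {perm K.-bseq T} := perm (inv_inj (@toggle_bseqK x)).

Lemma generatorK x : (generator x * generator x = 1)%g.
Proof. by apply/permP => w; rewrite permM !permE toggle_bseqK. Qed.

Definition walk (g : {perm K.-bseq T}) w :=
  foldl (fun h x => h * generator x)%g g w.

Lemma walkE g w : walk g w = (g * walk 1 w)%g.
Proof.
elim/last_ind: w => [|w x IHw]; first by rewrite mulg1.
by rewrite /walk !foldl_rcons -!/(walk _ _) IHw mulgA.
Qed.

(** Permutations compose from left to right, so each new letter acts on the reversed word built so
    far. Reducedness keeps it from cancelling the head, and the size bound keeps the result inside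
    the ball. *)
Lemma walk_nil w : reduced w -> (size w <= K)%N ->
  walk 1 w (@Bseq K T [::] isT) = rev w :> seq T.
Proof.
elim/last_ind: w => [|w x IHw]; first by rewrite perm1.
rewrite -reduced_rev rev_rcons reduced_cons reduced_rev size_rcons.
move=> /andP[hw rw] wK.
rewrite /walk foldl_rcons -/(walk _ _) permM permE /toggle_bseq val_insubd.
rewrite size_toggle ?size_bseq // IHw //; last exact: ltnW.
by rewrite /toggle reduced_rev rw (negPf hw) size_rev wK.
Qed.

(** This is the large girth: once [g] is cancelled, the action on the empty word tells short reduced
    words apart. *)
Lemma walk_inj g w w' : reduced w -> reduced w' ->
  (size w <= K)%N -> (size w' <= K)%N -> walk g w = walk g w' -> w = w'.
Proof.
move=> rw rw' wK wK'; rewrite walkE [RHS]walkE => /mulgI ww'.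
by apply: (can_inj revK); rewrite -!walk_nil ?ww'.
Qed.

Local Notation G := {perm K.-bseq T}.

(* [(b, g)] is the offline ([b = true]) or online copy of the vertex g. *)
Definition edge_at (b : bool) (g : G) x : G * G :=
  if b then (g, g * generator x)%g else (g * generator x, g)%g.

Lemma edge_atN b g x : edge_at (~~ b) (g * generator x)%g x = edge_at b g x.
Proof. by case: b; rewrite /edge_at /= -mulgA generatorK mulg1. Qed.

Fixpoint last_edge b g x w : G * G :=
  if w is y :: w' then last_edge (~~ b) (g * generator x)%g y w'
  else edge_at b g x.

Lemma last_edgeE b g x w :
  last_edge b g x w = edge_at (b (+) odd (size w)) (walk g (belast x w))
    (last x w).
Proof.
elim: w b g x => [|y w IHw] b g x /=; first by rewrite addbF.
by rewrite IHw addNb addbN.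
Qed.

(** If both walks cross the edge in the same direction, they have the same end and [walk_inj]
    applies. Otherwise each walk would be the other one without its last letter, which is impossible
    by length. *)
Lemma last_edge_inj b g x w x' w' : reduced (x :: w) -> reduced (x' :: w') ->
  (size w < K)%N -> (size w' < K)%N ->
  last_edge b g x w = last_edge b g x' w' -> x :: w = x' :: w'.
Proof.
have red y v : reduced (y :: v) -> reduced (belast y v).
  by rewrite lastI -cats1 => /cat_sorted2[].
move=> r r' wK wK'; rewrite !last_edgeE.
have: (walk g (belast x w) * generator (last x w) = walk g (x :: w))%g.
  by rewrite /walk [x :: w]lastI foldl_rcons.
have: (walk g (belast x' w') * generator (last x' w') = walk g (x' :: w'))%g.
  by rewrite /walk [x' :: w']lastI foldl_rcons.
have sz : ~ (size w = (size w').+1 /\ (size w).+1 = size w').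
  by case=> ->; elim: (size w') => [//|n IHn] [].
rewrite /edge_at => -> ->.
case: ifP => _; case: ifP => _ [H1 H2].
- by apply: (@walk_inj g).
- case: sz; split.
    rewrite -(size_belast x w) (@walk_inj g (belast x w) (x' :: w')) //.
    - exact: red.
    - by rewrite size_belast ltnW.
  rewrite -(size_belast x' w') -(@walk_inj g (x :: w) (belast x' w')) //.
  - exact: red.
  - by rewrite size_belast ltnW.
- case: sz; split.
    rewrite -(size_belast x w) (@walk_inj g (belast x w) (x' :: w')) //.
    - exact: red.
    - by rewrite size_belast ltnW.
  rewrite -(size_belast x' w') -(@walk_inj g (x :: w) (belast x' w')) //.
  - exact: red.
  - by rewrite size_belast ltnW.
- by apply: (@walk_inj g).
Qed.

End Toggle.

(** * Truncated Karp-Sipser messages *)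

Section Messages.
Variables (K : nat) (T : finType).
Local Notation G := {perm K.-bseq T}.
Implicit Types (b : bool) (g : G) (x y z : T) (E : {set G * G}).

(* True when some maximum matching of the depth-t tree hanging off (b, g) away
   from its x-edge leaves (b, g) exposed. *)
Fixpoint message t b g x E : bool :=
  if t is t'.+1 then
    [forall y, (y != x) ==>
      ~~ ((edge_at b g y \in E) && message t' (~~ b) (g * generator K y)%g y E)]
  else false.

(** The neighbour across the [y]-edge is joined to [(b, g)] and sends it 1. *)
Definition active t b g y E : bool :=
  (edge_at b g y \in E) && message t (~~ b) (g * generator K y)%g y E.

Lemma messageS t b g x E :
  message t.+1 b g x E = [forall y, (y != x) ==> ~~ active t b g y E].
Proof. by []. Qed.

Definition covered1 t b g E : bool := [exists y, active t b g y E].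

Definition covered2 t b g E : bool :=
  [exists y, exists z, [&& y != z, active t b g y E & active t b g z E]].

Lemma message_mono t t' E :
  (forall b g x, message t b g x E -> message t' b g x E) ->
  forall b g x, message t'.+1 b g x E -> message t.+1 b g x E.
Proof.
move=> tt' b g x; rewrite !messageS => /forallP m; apply/forallP => y.
apply/implyP => yx; apply: contra (implyP (m y) yx) => /andP[yE my].
by rewrite /active yE tt'.
Qed.

(** One step of the recursion reverses the order of messages, so two steps preserve it; at depth 0
    every message has the least value. *)
Lemma message_even_mono k E b g x :
  message k.*2 b g x E -> message k.+1.*2 b g x E.
Proof.
elim: k b g x => [//|k IHk] b g x.
by rewrite ![_.+1.*2]doubleS; do 2 apply: message_mono; rewrite -doubleS.
Qed.

(** Suppose the online end [v] receives no 1 at depth 2k+1. In particular [g] sends it 0, so [g]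
    receives a 1 at depth 2k from another neighbour, and still does at depth 2k+2 by monotonicity.
    Moreover [v] sends 1 to [g] at depth 2k+2, which makes two. *)
Lemma edge_covered k g x E : edge_at true g x \in E ->
  covered2 k.+1.*2 true g E ||
  covered1 k.*2.+1 false (g * generator K x)%g E.
Proof.
set v := (g * generator K x)%g => gE.
have vx : (v * generator K x = g)%g by rewrite -mulgA generatorK mulg1.
have vE : edge_at false v x \in E by rewrite (@edge_atN K T true).
rewrite orbC -implyNb; apply/implyP; rewrite negb_exists => /forallP v0.
have := v0 x; rewrite /active vE vx /= => /forallPn[y].
rewrite negb_imply negbK => /andP[yx /andP[yE my]].
apply/existsP; exists y; apply/existsP; exists x; apply/and3P; split=> //.
  by apply/andP; split=> //; exact: message_even_mono.
apply/andP; split=> //; rewrite doubleS messageS.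
by apply/forallP => z; apply/implyP => _; exact: v0.
Qed.

(** The edges that the message reads. Prefixing [x] to the reduced word forbids a start back along
    the [x]-edge. *)
Definition message_edges t b g x (e : G * G) : Prop := exists y w,
  [/\ reduced [:: x, y & w], (size w < t)%N & e = last_edge b g y w].

Definition branch t b g y (e : G * G) : Prop := exists w,
  [/\ reduced (y :: w), (size w <= t)%N & e = last_edge b g y w].

Lemma edge_at_branch t b g y : branch t b g y (edge_at b g y).
Proof. by exists [::]. Qed.

Lemma message_edges_branch t b g y e :
  message_edges t (~~ b) (g * generator K y)%g y e -> branch t b g y e.
Proof. by move=> [z [w [r wt ->]]]; exists (z :: w). Qed.

Lemma message_determined t b g x :
  determined_by (message_edges t b g x) (message t b g x).
Proof.
elim: t b g x => [//|t IHt] b g x E F EF; apply: eq_forallb => y.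
case: eqVneq => //= yx; congr (~~ (_ && _)).
  by apply: EF; exists y, [::]; rewrite /reduced /= (eq_sym x) yx.
apply: IHt => e [z [w [r wt ->]]]; apply: EF; exists y, (z :: w); split => //.
by move: r; rewrite /reduced /= (eq_sym x) yx.
Qed.

Lemma active_determined t b g y :
  determined_by (branch t b g y) (active t b g y).
Proof.
move=> E F EF; congr (_ && _); first exact/EF/edge_at_branch.
by apply: message_determined => e /message_edges_branch; exact: EF.
Qed.

(** The source of independence between neighbours: a common edge would end two reduced walks with
    different first colours. *)
Lemma branch_disjoint t b g y z e : (t < K)%N -> y != z ->
  branch t b g y e -> ~ branch t b g z e.
Proof.
move=> tK yz [w [r wt ->]] [w' [r' wt']] /last_edge_inj H.
have [zy _] : y :: w = z :: w' by apply: H; rewrite ?(leq_ltn_trans _ tK).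
by rewrite zy eqxx in yz.
Qed.

(** * Probabilities of the message events *)

Section Mean.
Variables (R : comRingType) (r : R) (p : G * G -> R).
Hypothesis p_edge : forall b g x, p (edge_at b g x) = r.

Fixpoint message_prob t : R :=
  if t is t'.+1 then (1 - r * message_prob t') ^+ #|T|.-1 else 0.

(** The message across the [y]-edge does not read that edge: a reduced walk of several letters
    cannot end in the same edge as the walk [[:: y]]. *)
Lemma mean_active t b g y : (t < K)%N ->
  mean p (fun E => (active t b g y E)%:R) =
  r * mean p (fun E => (message t (~~ b) (g * generator K y)%g y E)%:R).
Proof.
move=> tK; rewrite -(p_edge b g y) -(mean_in p (edge_at b g y)).
rewrite -(@meanM _ _ p (eq (edge_at b g y))
  (message_edges t (~~ b) (g * generator K y)%g y) (fun E => (_ \in E)%:R)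
  (fun E => (message t (~~ b) (g * generator K y)%g y E)%:R)).
- by apply: eq_mean => E; rewrite -natrM mulnb.
- move=> _ <- [z [w [red wt]]].
  move/(@last_edge_inj K T b g y [::] y (z :: w)) => H.
  by have: [:: y] = [:: y, z & w] by apply: H => //; exact: leq_ltn_trans tK.
- by move=> E F ->.
- by move=> E F EF; rewrite (message_determined EF).
Qed.

(** The predicate [c] prescribes which neighbours are active: [pred0] gives the event that none is,
    [pred1 y] the event that exactly [y] is. *)
Lemma mean_prod_active t b g (c : pred T) (s : seq T) : (t < K)%N ->
  uniq s ->
  mean p (fun E => \prod_(y <- s)
    (if c y then (active t b g y E)%:R else 1 - (active t b g y E)%:R)) =
  \prod_(y <- s) (if c y then mean p (fun E => (active t b g y E)%:R)
                  else 1 - mean p (fun E => (active t b g y E)%:R)).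
Proof.
move=> tK us; rewrite (@mean_prod _ _ p T s (branch t b g)
  (fun y E => if c y then
  (active t b g y E)%:R else 1 - (active t b g y E)%:R)) //.
- by apply: eq_bigr => y _; case: ifP => // _; rewrite meanB mean_cst.
- by move=> y z _ _ e yz; exact: branch_disjoint.
- by move=> y _ E F EF; rewrite (active_determined EF).
Qed.

Lemma natr_forall (P c : pred T) :
  [forall y, P y ==> ~~ c y]%:R = \prod_(y | P y) (1 - (c y)%:R) :> R.
Proof.
case: forallP => [c0|/forallP/forallPn[y]].
  rewrite big1 // => y Py.
  by rewrite (negPf (implyP (c0 y) Py)) subr0.
rewrite negb_imply negbK => /andP[Py cy].
by rewrite (bigD1 y) //= cy subrr mul0r.
Qed.

Lemma mean_message t b g x : (t <= K)%N ->
  mean p (fun E => (message t b g x E)%:R) = message_prob t.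
Proof.
elim: t b g x => [|t IHt] b g x tK; first exact: mean_cst.
under eq_mean => E do rewrite messageS natr_forall -big_filter.
rewrite (@mean_prod_active _ _ _ pred0) ?filter_uniq ?index_enum_uniq //.
under eq_bigr do rewrite mean_active // IHt 1?ltnW //.
by rewrite big_filter prodr_const cardC1.
Qed.

Lemma mean_activeE t b g y : (t < K)%N ->
  mean p (fun E => (active t b g y E)%:R) = r * message_prob t.
Proof. by move=> tK; rewrite mean_active // mean_message // ltnW. Qed.

Lemma mean_covered1 t b g : (t < K)%N ->
  mean p (fun E => (covered1 t b g E)%:R) =
  1 - (1 - r * message_prob t) ^+ #|T|.
Proof.
move=> tK.
have e1 E : (covered1 t b g E)%:R =
    1 - \prod_y (1 - (active t b g y E)%:R) :> R.
  rewrite -(natr_forall predT) /covered1 -[in RHS](negbK [forall _, _]).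
  rewrite negb_forall; under [in RHS]eq_existsb do rewrite negbK.
  by case: [exists _, _]; rewrite /= ?subr0 ?subrr.
under eq_mean => E do rewrite e1.
rewrite meanB mean_cst (@mean_prod_active _ _ _ pred0) ?index_enum_uniq //.
by under eq_bigr do rewrite mean_activeE //; rewrite prodr_const.
Qed.

(** At least two is the complement of none and of exactly one; the summand at [y] indicates that [y]
    alone is active. *)
Lemma natr_covered2 t b g E : (covered2 t b g E)%:R =
  1 - \prod_y (1 - (active t b g y E)%:R) -
  \sum_y \prod_z (if z == y then (active t b g z E)%:R
                  else 1 - (active t b g z E)%:R) :> R.
Proof.
rewrite /covered2.
rewrite /covered2.
have prodE y : \prod_z (if z == y then (active t b g z E)%:R
      else 1 - (active t b g z E)%:R) =
    (active t b g y E)%:R *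
    [forall z, (z != y) ==> ~~ active t b g z E]%:R :> R.
  rewrite (bigD1 y) //= eqxx natr_forall; congr (_ * _).
  by apply: eq_bigr => z /negPf ->.
rewrite [in RHS](eq_bigr _ (fun y _ => prodE y)).
have [/existsP[y ay]|] := boolP [exists y, active t b g y E]; last first.
  rewrite negb_exists => /forallP a0.
  rewrite big1 => [|y _]; last by rewrite (negPf (a0 y)) subr0.
  rewrite big1 => [|y _]; last by rewrite (negPf (a0 y)) mul0r.
  rewrite !subr0 subrr; case: existsP => // -[y /existsP[z]].
  by rewrite (negPf (a0 y)) andbF.
rewrite (bigD1 y) //= ay subrr mul0r subr0 (bigD1 y) //= ay mul1r.
rewrite [X in _ - (_ + X)]big1 ?addr0 => [|z zy]; last first.
  case: forallP => [/(_ y)|]; last by rewrite mulr0.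
  by rewrite eq_sym zy ay.
case: forallP => [a0|/forallP/forallPn[z]].
  rewrite subrr; case: existsP => // -[z /existsP[z' /and3P[zz' az az']]].
  have := a0 z; have := a0 z'; rewrite az az' !implybF !negbK.
  move=> /eqP z'y /eqP zy.
  by rewrite z'y zy eqxx in zz'.
rewrite negb_imply negbK => /andP[zy az]; rewrite subr0.
by case: existsP => // -[]; exists z; apply/existsP; exists y; rewrite zy az ay.
Qed.

Lemma mean_covered2 t b g : (t < K)%N ->
  mean p (fun E => (covered2 t b g E)%:R) =
  1 - (1 - r * message_prob t) ^+ #|T| -
  #|T|%:R * (r * message_prob t * (1 - r * message_prob t) ^+ #|T|.-1).
Proof.
move=> tK; under eq_mean => E do rewrite natr_covered2.
rewrite !meanB mean_cst (@mean_prod_active _ _ _ pred0) ?index_enum_uniq //.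
under eq_bigr do rewrite mean_activeE //; rewrite prodr_const mean_sum.
congr (_ - _); rewrite mulr_natl -sumr_const; apply: eq_bigr => y _.
rewrite (@mean_prod_active _ _ _ (pred1 y)) ?index_enum_uniq //.
rewrite (bigD1 y) //= eqxx mean_activeE //; congr (_ * _).
rewrite -(cardC1 y) -prodr_const; apply: eq_bigr => z /negPf /= ->.
by rewrite mean_activeE.
Qed.

End Mean.
End Messages.

(** * Convergence of the message densities *)

Section Limit.
Variable R : realType.
Implicit Types (x y : R) (d t : nat).

(** For x <= y, factoring out exp(-x), at most exp(-c), leaves 1 - exp(-(y - x)), at most y - x. *)
Lemma expRN_lipschitz c x y : c <= x -> c <= y ->
  `|expR (- x) - expR (- y)| <= expR (- c) * `|x - y|.
Proof.
wlog xy : x y / x <= y => [W cx cy|cx cy].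
  have [xy|/ltW yx] := leP x y; first exact: W.
  by rewrite distrC (distrC x); exact: W.
have yx0 : 0 <= y - x by rewrite subr_ge0.
rewrite (distrC x) [`|y - x|]ger0_norm // ger0_norm; last first.
  by rewrite subr_ge0 ler_expR lerN2.
have -> : expR (- x) - expR (- y) = expR (- x) * (1 - expR (- (y - x))).
  by rewrite mulrBr mulr1 -expRD; congr (_ - expR _); ring.
apply: ler_pM; rewrite ?expR_ge0 ?ler_expR ?lerN2 //.
  by rewrite subr_ge0 -[leRHS]expR0 ler_expR oppr_le0.
by have := expR_ge1Dx (- (y - x)); lra.
Qed.

(** With n the exponent, it suffices to compare one factor with exp(-x/n), using exp(x/n) >= 1 +
    x/n. The product of 1 + x/n and 1 - x/(n+1) exceeds 1 by x(1 - x)/(n(n+1)), which is where x <=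
    1 enters. *)
Lemma expR_le_expn_1B x d : 0 <= x <= 1 ->
  expR (- x) <= (1 - x / d.+1%:R) ^+ d.
Proof.
move=> /andP[x0 x1]; case: d => [|d].
  by rewrite expr0 -expR0 ler_expR oppr_le0.
have d0 : 0 < d.+1%:R :> R by rewrite ltr0n.
have d2 : d.+2%:R = d.+1%:R + 1 :> R by rewrite -natr1.
have dx : 0 < 1 - x / d.+2%:R.
  by rewrite subr_gt0 ltr_pdivrMr ?ltr0n // mul1r d2; lra.
have -> : - x = (- x / d.+1%:R) * d.+1%:R by rewrite divfK // gt_eqF.
rewrite expRM_natr lerXn2r ?nnegrE ?expR_ge0 ?(ltW dx) //.
rewrite mulNr expRN -[leRHS]invrK lef_pV2 ?posrE ?expR_gt0 ?invr_gt0 //.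
apply: le_trans (expR_ge1Dx _).
rewrite -[leLHS]mul1r ler_pdivrMr // d2 -subr_ge0.
have -> : (1 + x / d.+1%:R) * (1 - x / (d.+1%:R + 1)) - 1 =
    x * (1 - x) / (d.+1%:R * (d.+1%:R + 1)).
  by field; apply/andP; split; lra.
by apply: divr_ge0; nra.
Qed.

(** The power lies between exp(-x) and exp(-y) with y = dx/(d+1), which differs from x by at most
    1/(d+1). *)
Lemma expn_1B_approx x d : 0 <= x <= 1 ->
  `|(1 - d.+1%:R^-1 * x) ^+ d - expR (- x)| <= d.+1%:R^-1.
Proof.
move=> /[dup] x01 /andP[x0 x1]; rewrite [_ * x]mulrC.
have d0 : 0 < d.+1%:R :> R by rewrite ltr0n.
rewrite ger0_norm ?subr_ge0 ?expR_le_expn_1B //.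
have xd1 : x / d.+1%:R <= 1.
  by rewrite ler_pdivrMr // mul1r (le_trans x1) // ler1n.
set y := d%:R * (x / d.+1%:R).
have xy : x - y = x / d.+1%:R by rewrite /y -natr1; field; rewrite natr1; lra.
have y0 : 0 <= y by rewrite mulr_ge0 // divr_ge0 // ltW.
have yle : (1 - x / d.+1%:R) ^+ d <= expR (- y).
  have -> : - y = - (x / d.+1%:R) * d%:R by rewrite /y; ring.
  rewrite expRM_natr lerXn2r ?nnegrE ?expR_ge0 ?subr_ge0 //.
  by have := expR_ge1Dx (- (x / d.+1%:R)).
have := expRN_lipschitz y0 x0.
rewrite oppr0 expR0 mul1r (distrC y x) xy.
rewrite [`|x / _|]ger0_norm ?divr_ge0 // ?(ltW d0) //.
have xd : x / d.+1%:R <= d.+1%:R^-1 by rewrite ler_piMl // invr_ge0 ltW.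
move=> /(le_trans (ler_norm _)) yx; apply: le_trans xd.
by apply: le_trans yx; rewrite lerD2r.
Qed.

(** * The density recursion as a perturbed contraction *)

Section Recursion.
Variables (gamma : R) (d : nat) (q : nat -> R).
Hypotheses (gammaE : gamma = expR (- gamma)) (q0 : q 0%N = 0).
Hypothesis qS : forall t, q t.+1 = (1 - d.+1%:R^-1 * q t) ^+ d.
(** The Lipschitz constant of exp(-x) for x >= 1/e, a range that contains [gamma] and every [q t]
    with t >= 1. *)
Let c : R := expR (- expR (-1)).

Let c01 : 0 <= c < 1.
Proof. by rewrite expR_ge0 /= -expR0 ltr_expR oppr_lt0 expR_gt0. Qed.

Lemma recursion_01 t : 0 <= q t <= 1.
Proof.
elim: t => [|t /andP[q_ge0 q_le1]]; first by rewrite q0 lexx ler01.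
have d1 : d.+1%:R^-1 <= 1 :> R by rewrite invf_le1 ?ler1n // ltr0n.
have d0 : 0 <= d.+1%:R^-1 :> R by rewrite invr_ge0.
have : 0 <= 1 - d.+1%:R^-1 * q t <= 1.
  by rewrite subr_ge0 mulr_ile1 //= lerBlDr lerDl mulr_ge0.
by move=> /andP[y0 y1]; rewrite qS exprn_ge0 //= exprn_ile1.
Qed.

Lemma fixpoint_01 : expR (-1) <= gamma <= 1.
Proof.
have g0 : 0 < gamma by rewrite gammaE expR_gt0.
have g1 : gamma <= 1 by rewrite gammaE -expR0 ler_expR oppr_le0 ltW.
by rewrite g1 andbT [leRHS]gammaE ler_expR lerN2.
Qed.

(** Each step contracts by [c] and adds an error of at most 1/(d+1), and these errors form a
    geometric series. The count starts at [q 1], since [q 0] lies outside the range where [c]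
    contracts. *)
Lemma recursion_error t :
  `|q t.+1 - gamma| <= c ^+ t + d.+1%:R^-1 / (1 - c).
Proof.
have /andP[c0 c1] := c01; have /andP[ge g1] := fixpoint_01.
have d0 : 0 <= d.+1%:R^-1 :> R by rewrite invr_ge0.
have e0 : 0 < expR (-1) :> R by exact: expR_gt0.
elim: t => [|t IHt].
  rewrite expr0; apply: (@le_trans _ _ 1); last first.
    by rewrite lerDl divr_ge0 // subr_ge0 ltW.
  by have /andP[? ?] := recursion_01 1; rewrite ler_norml; lra.
rewrite qS [X in _ - X]gammaE.
have qe : expR (-1) <= q t.+1.
  have q01 := recursion_01 t.
  rewrite qS [_ * q t]mulrC; apply: le_trans (expR_le_expn_1B d q01).
  by rewrite ler_expR lerN2; case/andP: q01.
have A := expn_1B_approx d (recursion_01 t.+1).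
have B := expRN_lipschitz qe ge; rewrite -/c in B.
have C : c * `|q t.+1 - gamma| <= c * (c ^+ t + d.+1%:R^-1 / (1 - c)).
  exact: ler_wpM2l.
apply: le_trans (ler_distD (expR (- q t.+1)) _ _) _.
apply: le_trans (lerD A (le_trans B C)) _.
have c1' : 1 - c != 0 by rewrite subr_eq0 gt_eqF.
by rewrite exprS le_eqVlt; apply/orP; left; apply/eqP; set x := _^-1; field.
Qed.

(** The d-th powers are at least exp(-q), hence at least gamma - eta. Replacing both powers by gamma
    costs 2 eta, and replacing both factors of the last product costs 2 eta more; passing from
    exponent d+1 to d costs 1/(d+1) twice. *)
Lemma density_le (eta : R) t t' :
  `|q t - gamma| <= eta -> `|q t' - gamma| <= eta ->
  1 - (1 - d.+1%:R^-1 * q t) ^+ d.+1 +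
  (1 - (1 - d.+1%:R^-1 * q t') ^+ d.+1 -
   d.+1%:R * (d.+1%:R^-1 * q t' * (1 - d.+1%:R^-1 * q t') ^+ d)) <=
  2 - 2 * gamma - gamma ^+ 2 + (4 * eta + 2 * d.+1%:R^-1).
Proof.
move=> qt qt'.
set delta := d.+1%:R^-1.
have delta0 : 0 < delta by rewrite invr_gt0 ltr0n.
have delta1 : delta <= 1 by rewrite invf_le1 ?ler1n // ltr0n.
have dK : d.+1%:R * delta = 1 by rewrite mulfV // pnatr_eq0.
have /andP[ge g1] := fixpoint_01.
have e0 : 0 < expR (-1) :> R by exact: expR_gt0.
have g0 : 0 <= gamma by lra.
have near s : `|q s - gamma| <= eta ->
    gamma - eta <= (1 - delta * q s) ^+ d <= 1.
  move=> qs; have /andP[s0 s1] := recursion_01 s.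
  apply/andP; split; last first.
    have := recursion_01 s.+1; rewrite qS -/delta => /andP[_] //.
  rewrite [_ * q s]mulrC; apply: le_trans (expR_le_expn_1B d (recursion_01 s)).
  have := expRN_lipschitz s0 g0; rewrite oppr0 expR0 mul1r -gammaE.
  by move=> /le_trans /(_ qs) /ler_normlP[]; lra.
have /andP[a1 a2] := near _ qt; have /andP[b1 b2] := near _ qt'.
have /andP[q0' q1'] := recursion_01 t; have /andP[r0' r1'] := recursion_01 t'.
rewrite mulrA (mulrA d.+1%:R) dK mul1r !exprS.
have a0 : 0 <= (1 - delta * q t) ^+ d.
  by rewrite exprn_ge0 // subr_ge0 mulr_ile1 // ltW.
have b0 : 0 <= (1 - delta * q t') ^+ d.
  by rewrite exprn_ge0 // subr_ge0 mulr_ile1 // ltW.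
set A := (_ ^+ d) in a0 a1 a2 *; set B := (_ ^+ d) in b0 b1 b2 *.
move: qt qt'; rewrite !ler_norml => /andP[h1 h2] /andP[h3 h4].
have eta0 : 0 <= eta by lra.
have E1 : delta * q t * A <= delta by have := mulr_ile1 q0' a0 q1' a2; nra.
have E2 : delta * q t' * B <= delta by have := mulr_ile1 r0' b0 r1' b2; nra.
have E3 : gamma ^+ 2 - 2 * eta <= q t' * B.
  have F1 : (gamma - eta - q t') * B <= 0 by nra.
  have F2 : gamma * (gamma - eta - B) <= 0 by nra.
  nra.
nra.
Qed.

End Recursion.

Lemma density_limit (gamma eps : R) : gamma = expR (- gamma) -> 0 < eps ->
  exists d k, forall q : nat -> R, q 0%N = 0 ->
    (forall t, q t.+1 = (1 - d.+1%:R^-1 * q t) ^+ d) ->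
  1 - (1 - d.+1%:R^-1 * q k.*2.+1) ^+ d.+1 +
  (1 - (1 - d.+1%:R^-1 * q k.+1.*2) ^+ d.+1 -
   d.+1%:R * (d.+1%:R^-1 * q k.+1.*2 * (1 - d.+1%:R^-1 * q k.+1.*2) ^+ d)) <=
  2 - 2 * gamma - gamma ^+ 2 + eps.
Proof.
move=> gammaE eps0; pose c : R := expR (- expR (-1)).
have c0 : 0 <= c by exact: expR_ge0.
have c1 : c < 1 by rewrite -expR0 ltr_expR oppr_lt0 expR_gt0.
(* Half of [eps] pays for 4 c^k, the other half for the terms in 1/(d+1), whose total coefficient is
   [M] below. *)
have [k ck] : exists k, c ^+ k < eps / 8.
  have : ((fun n => c ^+ n) @ \oo --> (0 : R))%classic.
    by apply: cvg_expr; rewrite ger0_norm.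
  move=> /cvgrPdist_lt /(_ (eps / 8)) [|n _ /(_ n (leqnn n))]; first lra.
  by rewrite sub0r normrN /= ger0_norm ?exprn_ge0 // => ?; exists n.
pose M := 4 / (1 - c) + 2.
have M0 : 0 < M by rewrite addr_gt0 // divr_gt0 // subr_gt0.
pose d := Num.truncn (2 * M / eps).
have dM : M * d.+1%:R^-1 <= eps / 2.
  rewrite ler_pdivrMr ?ltr0n // mulrAC ler_pdivlMr // -ler_pdivrMl //.
  by rewrite mulrC [M * 2]mulrC ltW // truncnS_gt.
exists d, k => q q0 qS.
pose eta := c ^+ k + d.+1%:R^-1 / (1 - c).
have err t : (k <= t)%N -> `|q t.+1 - gamma| <= eta.
  move=> kt; apply: le_trans (recursion_error gammaE q0 qS t) _.
  by rewrite lerD2r ler_wiXn2l // ltW.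
apply: le_trans (density_le gammaE q0 qS (err k.*2 _) (err k.*2.+1 _)) _.
- by rewrite -addnn leq_addr.
- by rewrite -addnn -addnS leq_addr.
rewrite lerD2l /eta.
have -> : 4 * (c ^+ k + d.+1%:R^-1 / (1 - c)) + 2 * d.+1%:R^-1 =
  4 * c ^+ k + M * d.+1%:R^-1 by rewrite /M; ring.
have ck' : 4 * c ^+ k <= eps / 2 by lra.
by apply: le_trans (lerD ck' dM) _; rewrite -splitr.
Qed.

End Limit.

(** * Matchings and vertex covers *)

Section AnyInstance.
Variables (R : realType) (I : instance R).
Implicit Types (e f : edge I) (h : history I) (z : scenario I) (pi : policy I).

Lemma matching_rcons h o : matching (rcons h o) =
  if exists_edge o && unmatched (matching h) (probed o)
  then (probed o |: matching h)%SET else matching h.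
Proof. by rewrite /matching foldl_rcons. Qed.

Lemma matching_inj h e f : e \in matching h -> f \in matching h ->
  e.1 = f.1 \/ e.2 = f.2 -> e = f.
Proof.
elim/last_ind: h e f => [|h o IHh] e f; first by rewrite inE.
rewrite matching_rcons; case: ifP => [/andP[_ /forallP um]|_]; last exact: IHh.
have new f' : f' \in matching h ->
    ~ ((probed o).1 = f'.1 \/ (probed o).2 = f'.2).
  move=> f'h; have := um f'; rewrite f'h /= => /andP[n1 n2].
  by case=> [e1|e2]; [rewrite e1 eqxx in n1 | rewrite e2 eqxx in n2].
rewrite !inE => /predU1P[->|eh] /predU1P[->|fh] // ef.
- by case: (new f).
- by case: (new e) => //; case: ef => [->|->]; [left|right].
- exact: IHh.
Qed.

Lemma run_truthful pi z n h :
  all (fun o => exists_edge o == (probed o \in z.1)) h ->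
  all (fun o => exists_edge o == (probed o \in z.1)) (run pi z n h).
Proof.
elim: n h => [//|n IHn] h hh /=; case: (pi h) => [e|//].
by case: ifP => // _; apply: IHn; rewrite all_rcons hh /= eqxx.
Qed.

Lemma matching_run pi z n e : e \in matching (run pi z n [::]) -> e \in z.1.
Proof.
have := @run_truthful pi z n [::] isT.
elim/last_ind: (run _ _ _ _) => [|h o IHh].
  by rewrite inE.
rewrite all_rcons => /andP[/eqP eo /IHh{}IHh]; rewrite matching_rcons.
case: ifP => [/andP[oe _]|//]; rewrite !inE => /predU1P[->|//].
by rewrite -eo.
Qed.

(** Weak duality: edges of a matching share no endpoint, so those covered by [P] inject into [P] and
    those covered by [Q] into [Q]. *)
Lemma card_matching_cover h (P : pred (offline I)) (Q : pred (online I)) :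
  (forall e, e \in matching h -> P e.1 || Q e.2) ->
  (#|matching h| <= #|P| + #|Q|)%N.
Proof.
move=> cov; pose A := finset.finset (fun e => (e \in matching h) && P e.1).
pose B := finset.finset (fun e => (e \in matching h) && Q e.2).
have AB : matching h \subset A :|: B.
  by apply/fintype.subsetP => e eh; rewrite !inE eh /= cov.
apply: leq_trans (subset_leq_card AB) _; apply: leq_trans (leq_card_setU _ _) _.
apply: leq_add.
- rewrite -(@card_in_imset _ _ fst A) => [|e f].
    apply/subset_leq_card/fintype.subsetP => u /imsetP[e]; rewrite inE.
    by move=> /andP[_ Pe] ->.
  rewrite !inE => /andP[eh _] /andP[fh _] ef; apply: (matching_inj eh fh).
  by left.
- rewrite -(@card_in_imset _ _ snd B) => [|e f].
    apply/subset_leq_card/fintype.subsetP => u /imsetP[e]; rewrite inE.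
    by move=> /andP[_ Pe] ->.
  rewrite !inE => /andP[eh _] /andP[fh _] ef; apply: (matching_inj eh fh).
  by right.
Qed.

End AnyInstance.

(** * The hard instances *)

Lemma probability_diracE (R : realType) (k : nat) (A : set nat) :
  (\d_k : probability nat R) A = (k \in A)%:R%:E.
Proof. exact: diracE. Qed.

(** * Instances with a common deterministic patience *)

Section DiracPatience.
Variables (R : realType) (I : instance R) (k : nat).
Hypothesis patienceE : forall v, patience (i := I) v = \d_k.

Lemma scenario_prob_dirac (E : {set edge I}) (theta : {ffun online I -> nat}) :
  scenario_prob (E, theta) =
  bern (fun e => prob e.1 e.2) E * (theta == [ffun=> k])%:R.
Proof.
rewrite /scenario_prob /=; congr (_ * _).
have [->|] := eqVneq; first by rewrite big1 // => v _;
  rewrite patienceE probability_diracE ffunE mem_set.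
move=> /eqP ne; apply/eqP; rewrite prodf_seq_eq0.
apply/hasP; case: (pickP (fun v => theta v != k)) => [v vk|all_k].
  exists v; rewrite ?mem_index_enum //= patienceE probability_diracE memNset //.
  by move=> /= kv; rewrite -kv eqxx in vk.
by case: ne; apply/ffunP => v; rewrite ffunE; apply/eqP/negbFE/all_k.
Qed.

Lemma bern_ge0 (E : {set edge I}) : 0 <= bern (fun e => prob e.1 e.2) E.
Proof.
apply: prodr_ge0 => e _; have /andP[p0 p1] := prob_01 e.1 e.2.
by case: ifP => // _; rewrite subr_ge0.
Qed.

Lemma reward_ge0 pi (z : scenario I) : 0 <= reward pi z.
Proof. by apply: sumr_ge0 => e _; exact: weight_ge0. Qed.

(** Scenarios form an infinite type, but all the mass sits on the constant patience [k], which
    leaves a finite sum over edge sets. *)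
Lemma esum_scenario_dirac pi :
  (\esum_(z in [set: scenario I]) (scenario_prob z * reward pi z)%:E)%E =
  (mean (fun e => prob e.1 e.2) (fun E => reward pi (E, [ffun=> k])))%:E.
Proof.
pose j (E : {set edge I}) : scenario I := (E, [ffun=> k]).
transitivity (\esum_(z in range j) (scenario_prob z * reward pi z)%:E)%E.
  rewrite [RHS]esum_mkcond; apply: eq_esum => -[E theta] _.
  case: ifPn => // Ej; rewrite scenario_prob_dirac.
  have [tk|_] := eqVneq theta; last by rewrite mulr0 mul0r.
  by move: Ej; rewrite notin_setE => -[]; exists E; rewrite // /j tk.
rewrite esum_image; last by move=> E F _ _ [].
have setTE : ([set: {set edge I}] = [set` predT])%classic by apply/seteqP.
rewrite esum_fset; first last.
- move=> E _; rewrite lee_fin scenario_prob_dirac.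
  by rewrite !mulr_ge0 ?bern_ge0 ?reward_ge0.
- exact: finite_finset.
rewrite setTE -(@bigfs _ _ _ _ (index_enum {set edge I})) ?index_enum_uniq //;
  last first.
  by move=> E _; rewrite mem_index_enum.
rewrite sumEFin; congr (_%:E); apply: eq_bigr => E _.
by rewrite scenario_prob_dirac eqxx mulr1.
Qed.

(** A randomised algorithm is a convex combination of policies. *)
Lemma opt_dirac_le (B : R) :
  (forall pi : policy I, mean (fun e => prob e.1 e.2)
                (fun E => reward pi (E, [ffun=> k])) <= B) ->
  (opt I <= B%:E)%E.
Proof.
move=> HB; apply: ge_ereal_sup => _ [A _ <-].
rewrite /expected_weight -[B]mul1r -(seed_prob_sum A) mulr_suml -sumEFin.
apply: lee_sum => s _; rewrite esum_scenario_dirac -EFinM lee_fin.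
by rewrite ler_wpM2l // seed_prob_ge0.
Qed.

End DiracPatience.

(** * The instance built on the Cayley graph *)

Section HighGirthInstance.
Variables (R : realType) (K : nat) (T : finType).
Hypotheses (K_gt0 : (0 < K)%N) (T_gt0 : (0 < #|T|)%N).
Local Notation G := {perm K.-bseq T}.

Definition cayley_prob (u v : G) : R :=
  if [exists x, v == u * generator K x]%g then #|T|%:R^-1 else 0.

Lemma cayley_prob_01 u v : 0 <= cayley_prob u v <= 1.
Proof.
rewrite /cayley_prob; case: ifP => _; last by rewrite lexx ler01.
by rewrite invr_ge0 ler0n invf_le1 ?ler1n ?ltr0n.
Qed.

Lemma cayley_probC u v : cayley_prob u v = cayley_prob v u.
Proof.
rewrite /cayley_prob; congr (if _ then _ else _).
by apply: eq_existsb => x; apply/eqP/eqP => ->; rewrite -mulgA generatorK mulg1.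
Qed.

Lemma cayley_prob_edge b g x :
  cayley_prob (@edge_at K T b g x).1 (edge_at b g x).2 = #|T|%:R^-1.
Proof.
have out h : cayley_prob h (h * generator K x)%g = #|T|%:R^-1.
  by rewrite /cayley_prob; case: existsP => // -[]; exists x.
by case: b; rewrite /edge_at /= ?(cayley_probC (_ * _)%g) out.
Qed.

(** Since [K > 0], one-letter words lead to distinct vertices, so every vertex has exactly [#|T|]
    neighbours. *)
Lemma sum_cayley_prob u : \sum_v cayley_prob u v = 1.
Proof.
have inj : injective (fun x => u * generator K x)%g.
  move=> x y; move/(@walk_inj K T u [:: x] [:: y]) => H.
  by have [] := H isT isT K_gt0 K_gt0.
have -> : 1 = \sum_(x : T) #|T|%:R^-1 :> R.
  by rewrite sumr_const -[RHS]mulr_natl mulfV // pnatr_eq0 -lt0n.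
transitivity (\sum_(v in [set u * generator K x | x : T]%g) #|T|%:R^-1 : R).
  rewrite [RHS]big_mkcond; apply: eq_bigr => v _; rewrite /cayley_prob.
  congr (if _ then _ else _); apply/existsP/imsetP => [[x /eqP->]|[x _ ->]].
    by exists x.
  by exists x.
by rewrite big_imset //= => x y _ _; exact: inj.
Qed.

Lemma dirac_patience_gt0 :
  (\d_#|G| : probability nat R) [set 0%N]%classic = 0%E.
Proof.
rewrite probability_diracE memNset //= => G0.
by have := card0_eq G0 (1%g : G); rewrite inE.
Qed.

(** Patience [#|G|] acts as unlimited, an online vertex having only [#|G|] incident pairs; the
    all-one solution meets the patience constraint with equality. *)
Definition cayley_instance : instance R :=
  @Instance R G G (fun=> 1) cayley_prob (fun=> \d_#|G|)
    (fun=> ler01) cayley_prob_01 (fun=> dirac_patience_gt0).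

Lemma expectation_dirac_nat n :
  ('E_(\d_n : probability nat R)[fun k : nat => k%:R])%E = n%:R%:E.
Proof.
rewrite unlock integral_dirac //.
by rewrite diracE mem_set // mul1e.
Qed.

Lemma lp_value_cayley : lp_value cayley_instance = #|G|%:R%:E.
Proof.
apply/eqP; rewrite eq_le; apply/andP; split.
  apply: ge_ereal_sup => _ [x [xu _ _ _] <-]; rewrite lee_fin.
  rewrite -sum1_card natr_sum; apply: ler_sum => u _; apply: le_trans (xu u).
  by apply: ler_sum => v _; rewrite mulr1.
apply: ereal_sup_ubound; exists (fun _ _ => 1).
  split => [u|v|v|u v].
  - by under eq_bigr do rewrite mul1r; rewrite sum_cayley_prob.
  - under eq_bigr do rewrite mul1r /= cayley_probC.
    by rewrite sum_cayley_prob.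
  - by rewrite /= expectation_dirac_nat sumr_const.
  - by rewrite ler01 lexx.
rewrite /lp_objective; congr (_%:E).
rewrite -sum1_card natr_sum; apply: eq_bigr => u _.
by under eq_bigr do rewrite mulr1 mul1r; rewrite sum_cayley_prob.
Qed.

Let p (e : G * G) : R := cayley_prob e.1 e.2.

(** Pairs outside the graph have probability 0. The cover is described for edges of the graph only,
    so the reward is bounded on edge sets of nonzero weight. *)
Lemma bern_cayley_neq0 (E : {set G * G}) e : bern p E != 0 -> e \in E ->
  exists g x, e = edge_at true g x.
Proof.
move=> /prodf_neq0 /(_ e isT) pe eE; move: pe; rewrite eE /p /cayley_prob.
case: existsP => [[x /eqP e2]|]; last by rewrite eqxx.
by exists e.1, x; rewrite {1}(surjective_pairing e) e2.
Qed.

Lemma reward_cayley k pi (E : {set G * G}) : bern p E != 0 ->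
  reward (I := cayley_instance) pi (E, [ffun=> #|G|]) <=
  \sum_g (covered2 k.+1.*2 true g E)%:R +
  \sum_g (covered1 k.*2.+1 false g E)%:R.
Proof.
move=> pE; rewrite /reward sumr_const.
set M := matching _.
rewrite -!natr_sum -natrD ler_nat.
have cardE (P : pred G) : (\sum_g P g)%N = #|P|.
  rewrite -sum1_card [RHS]big_mkcond; apply: eq_bigr => g _.
  by rewrite unfold_in; case: (P g).
rewrite (cardE (fun g => covered2 _ _ g _)) (cardE (fun g => covered1 _ _ g _)).
apply: card_matching_cover => e /matching_run /= eE.
have [g [x eg]] := bern_cayley_neq0 pE eE.
by rewrite eg in eE *; exact: edge_covered.
Qed.

Let q : nat -> R := message_prob T #|T|%:R^-1.

(** The cover bounds the reward pointwise, and the average of its size splits into the two vertex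
    densities; the depth condition keeps the walks short enough for independence. *)
Lemma opt_cayley_le k : (k.+1.*2 < K)%N ->
  (opt cayley_instance <= (#|G|%:R *
    (1 - (1 - #|T|%:R^-1 * q k.*2.+1) ^+ #|T| +
     (1 - (1 - #|T|%:R^-1 * q k.+1.*2) ^+ #|T| -
      #|T|%:R * (#|T|%:R^-1 * q k.+1.*2 *
        (1 - #|T|%:R^-1 * q k.+1.*2) ^+ #|T|.-1))))%:E)%E.
Proof.
move=> kK.
have kK' : (k.*2.+1 < K)%N by rewrite (leq_trans _ kK) // doubleS ltnW.
apply: (@opt_dirac_le R cayley_instance #|G|) => // pi.
apply: (@le_trans _ _ (mean p (fun E =>
  \sum_g (covered2 k.+1.*2 true g E)%:R +
  \sum_g (covered1 k.*2.+1 false g E)%:R))).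
  apply: ler_sum => E _; have [pE|pE] := eqVneq (bern p E) 0.
    by rewrite [bern _ E]pE !mul0r.
  by rewrite ler_wpM2l ?reward_cayley // (bern_ge0 (I := cayley_instance)).
rewrite meanD !mean_sum.
have pE b g x : p (@edge_at K T b g x) = #|T|%:R^-1.
  exact: cayley_prob_edge.
rewrite (eq_bigr _ (fun g _ => mean_covered2 pE true g kK)).
rewrite (eq_bigr _ (fun g _ => mean_covered1 pE false g kK')).
by rewrite !sumr_const -mulrnDl addrC [leRHS]mulr_natl.
Qed.

End HighGirthInstance.

Local Open Scope classical_set_scope.

Theorem theorem7 (R : realType) (gamma : R) (hgamma : gamma = expR (- gamma)) :
  (stochasticity_gap (@lp_value R) <= (2 - 2 * gamma - gamma ^+ 2)%:E)%E.
Proof.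
apply/lee_addgt0Pr => eps eps0.
have [d [k density]] := density_limit hgamma eps0.
(* [K] exceeds by one the larger message depth [k.+1.*2], as [opt_cayley_le] demands. *)
pose T : finType := 'I_d.+1; pose K := k.+1.*2.+1.
have T0 : (0 < #|T|)%N by rewrite card_ord.
pose I := cayley_instance R K T0.
have G0 : 0 < #|{perm K.-bseq T}|%:R :> R.
  by rewrite ltr0n; apply/card_gt0P; exists 1%g.
have lpE : lp_value I = #|{perm K.-bseq T}|%:R%:E by exact: lp_value_cayley.
have := @opt_cayley_le R K T T0 k (leqnn _).
rewrite card_ord -/I => opt_le.
have {density} le_eps := density (message_prob T d.+1%:R^-1) erefl.
apply: (@le_trans _ _ (opt I / lp_value I)%E).
  by apply: ereal_inf_lbound; exists I; rewrite lpE lte_fin.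
rewrite lpE inver gt_eqF // lee_pdivrMr //.
apply: le_trans opt_le _; rewrite -EFinD -EFinM lee_fin mulrC.
rewrite ler_pM2r //; apply: le_eps => t.
by rewrite /= card_ord.
Qed.
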